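(* Let $W_7=\{(0,0,0),(1,1,1)\}$, $W_8=\{(0,0,1),(0,1,0),(1,0,0)\}$, $W_9=\{(0,0,0),(0,0,1),(0,1,0),(1,1,1)\}$, $W_{10}=\{(0,0,0),(0,0,1),(1,1,1)\}$ and $W_{12}=\{(0,0,0),(0,0,1),(0,1,0),(1,0,0)\}$, all subsets of $\{0,1\}^3$. Then the inducibility constants satisfy $\lambda(W_7)=1/3$, $\lambda(W_8)=2/3$, $\lambda(W_9)=4/9$, $\lambda(W_{10})=5/12$ and $\lambda(W_{12})=1/2$.
   Context: The $n$-hypercube $Q_n$ is the graph on $\{0,1\}^n$ in which two sequences are adjacent iff they differ in exactly one coordinate. A $d$-subcube of $\{0,1\}^n$ is a set $C\subseteq\{0,1\}^n$ obtained by fixing $n-d$ coordinates to constant values and letting the remaining $d$ coordinates vary arbitrarily; there are $\binom nd 2^{n-d}$ of them (equivalently, $C$ is a set whose induced subgraph $Q_n[C]$ is isomorphic to $Q_d$). For $H\subseteq\{0,1\}^d$ and $S\subseteq\{0,1\}^n$, a $d$-subcube $C$ gives a copy of $H$ in $S$ if there is a graph isomorphism $f$ from $Q_d$ to $Q_n[C]$ with $f(H)=S\cap C$. Let $\Lambda(H,S)$ be the number of $d$-subcubes giving a copy of $H$ in $S$, let $\Lambda(H,n)=\max\{\Lambda(H,S): S\subseteq\{0,1\}^n\}$ for $n\ge d$, and let the inducibility constant be $\lambda(H)=\lim_{n\to\infty}\Lambda(H,n)/\big(\binom nd 2^{n-d}\big)$ (the limit exists since the ratio is non-increasing in $n$).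 *)

(* Defs.v *)
From HB Require Import structures.
From mathcomp Require Import all_boot all_order all_algebra.
From mathcomp Require Import all_classical all_reals all_analysis.
Set Implicit Arguments. Unset Strict Implicit. Unset Printing Implicit Defensive.
Import Order.TTheory GRing.Theory Num.Theory.

Notation cube n := {ffun 'I_n -> bool}.

Definition qadj (n : nat) (x y : cube n) : bool :=
  #|[set i | x i != y i]| == 1%N.

Definition is_subcube (n d : nat) (C : {set cube n}) : bool :=
  [exists D : {set 'I_n}, (#|D| == d) &&
    [exists a : cube n,
       C == [set x : cube n | [forall i, (i \notin D) ==> (x i == a i)]]]].

Definition gives_copy (d n : nat) (H : {set cube d}) (S C : {set cube n}) : bool :=
  [exists f : {ffun cube d -> cube n},
    [&& injectiveb f,
        [forall x, f x \in C],
        [forall y in C, exists x, f x == y],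
        [forall x, forall y, qadj x y == qadj (f x) (f y)]
      & f @: H == S :&: C]].

Definition LambdaHS (d n : nat) (H : {set cube d}) (S : {set cube n}) : nat :=
  #|[set C : {set cube n} | is_subcube d C && gives_copy H S C]|.

Definition LambdaHn (d n : nat) (H : {set cube d}) : nat :=
  \max_(S : {set cube n}) LambdaHS H S.

Definition induc_ratio (R : realType) (d : nat) (H : {set cube d}) (n : nat) : R :=
  ((LambdaHn n H)%:R / ('C(n, d) * 2 ^ (n - d))%:R)%R.

Definition pt (b0 b1 b2 : bool) : cube 3 :=
  [ffun i : 'I_3 => nth false [:: b0; b1; b2] i].

Definition W7 : {set cube 3} := [set pt false false false; pt true true true].
Definition W8 : {set cube 3} :=
  [set pt false false true; pt false true false; pt true false false].
Definition W9 : {set cube 3} :=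
  [set pt false false false; pt false false true; pt false true false; pt true true true].
Definition W10 : {set cube 3} :=
  [set pt false false false; pt false false true; pt true true true].
Definition W12 : {set cube 3} :=
  [set pt false false false; pt false false true; pt false true false; pt true false false].

(* Main.v *)
Require Import Defs.
From Stdlib Require Import ZArith.
From HB Require Import structures.
From mathcomp Require Import all_boot all_order all_algebra.
From mathcomp Require Import all_classical all_reals all_analysis.
From mathcomp Require Import ssrZ zify ring lra.
Set Implicit Arguments. Unset Strict Implicit. Unset Printing Implicit Defensive.
Import Order.TTheory GRing.Theory Num.Theory.
Import numFieldNormedType.Exports.

(* For a vertex x and directions i, j, k, record the pattern of S on the points
   obtained from x by flipping subsets of {i, j, k}. Proper triples count each
   3-subcube 48 times, so lambda(H) is the largest asymptotic density of frames
   (x, i, j, k) whose pattern is equivalent to H.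

   Upper bounds are sums of squares. For an edge (x, x + e_i) with prescribed
   colours and a linear form l in the colours of the parallel edges, the sum
   over (j, k) of l(j) l(k) is a square; averaging such terms over the
   symmetries of the 3-cube leaves an inequality between functions of a single
   pattern, checked on the 256 patterns. As degenerate triples (i, j, k) are
   allowed, the squares are exact. W7 and W12 need one square, W9 three, W10
   six (coefficients found by semidefinite programming). W8 needs the 4-cube:
   if a square meets S in a diagonal, each direction extending it to a copy of
   W8 puts the third point over one of the two remaining vertices, and one uses
   the square of the difference of the two numbers of directions.

   Lower bounds: give the coordinates values in a finite abelian group
   according to their residue mod q, and let S be the set of points whose sum
   lies in T. Averaging over the translates of T makes the count exact. W7, W8:
   weight 0 mod 3; W12: weight 0 or 1 mod 4; W9: a third of the coordinates act
   by parity, the others by weight 0 or 1 mod 4; W10: six classes of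
   coordinates acting by parity, T being 24 points of the 6-cube coming from
   the Hadamard matrix of order 12. *)

Delimit Scope Z_scope with BZ.

(** * Frames and 3-subcubes *)

Definition flip (n : nat) (i : 'I_n) (a : bool) (x : cube n) : cube n :=
  [ffun t => x t (+) (a && (t == i))].

Lemma flipC (n : nat) (i j : 'I_n) (a b : bool) (x : cube n) :
  flip i a (flip j b x) = flip j b (flip i a x).
Proof. by apply/ffunP => t; rewrite !ffunE addbAC. Qed.

Lemma flip_add (n : nat) (i : 'I_n) (a b : bool) (x : cube n) :
  flip i a (flip i b x) = flip i (a (+) b) x.
Proof.
by apply/ffunP => t; rewrite !ffunE -addbA; case: (t == i); case: a; case: b.
Qed.

Lemma flip0 (n : nat) (i : 'I_n) (x : cube n) : flip i false x = x.
Proof. by apply/ffunP => t; rewrite !ffunE addbF. Qed.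

Lemma flipK (n : nat) (i : 'I_n) (a : bool) : involutive (@flip n i a).
Proof. by move=> x; rewrite flip_add addbb flip0. Qed.

Lemma qadj_flip (n : nat) (x y : cube n) :
  reflect (exists i, y = flip i true x) (qadj x y).
Proof.
apply: (iffP cards1P) => [[i Ei]|[i ->]]; exists i.
  apply/ffunP => t; rewrite ffunE /=.
  by have /setP/(_ t) := Ei; rewrite !inE => <-; case: (x t); case: (y t).
by apply/setP => t; rewrite !inE ffunE /=; case: (x t); case: (t == i).
Qed.

(** Two distinct neighbours of [x] have a single common neighbour besides [x]; comparing coordinate
    [i] of the two sides forces [t = i]. *)
Lemma flip_square (n : nat) (i j s t : 'I_n) (x : cube n) :
  i != j -> flip s true (flip i true x) = flip t true (flip j true x) ->
  flip s true (flip i true x) <> x ->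
  flip s true (flip i true x) = flip j true (flip i true x).
Proof.
move=> ij E ne; have [si|si] := eqVneq s i.
  by case: ne; rewrite si flip_add flip0.
have := congr1 (fun y : cube n => y i) E.
rewrite !ffunE /= eqxx (eq_sym i s) (negbTE si) (negbTE ij) /=.
have [ti|] := eqVneq t i; first by move=> _; rewrite E ti flipC.
by case: (x i).
Qed.

(** * The symmetries of the 3-cube *)

Notation cell := (bool * bool * bool)%type.

Definition cells : seq cell :=
  [:: (false, false, false); (true, false, false); (false, true, false);
      (true, true, false); (false, false, true); (true, false, true);
      (false, true, true); (true, true, true)].

Lemma mem_cells (v : cell) : v \in cells.
Proof. by case: v => [[[] []] []]. Qed.

Lemma all_cells (P : pred cell) : reflect (forall v, P v) (all P cells).
Proof.
by apply: (iffP allP) => [H v|H v _]; [apply: H; apply: mem_cells|apply: H].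
Qed.

Definition add_cell (s v : cell) : cell :=
  (s.1.1 (+) v.1.1, s.1.2 (+) v.1.2, s.2 (+) v.2).

(** The six coordinate permutations; every index from 5 on stands for the last one, and [auts] uses
    only [m < 6]. *)
Definition perm_cell (m : nat) (v : cell) : cell :=
  let: (a, b, c) := v in
  match m with
  | 0 => (a, b, c) | 1 => (b, a, c) | 2 => (a, c, b)
  | 3 => (c, b, a) | 4 => (b, c, a) | _ => (c, a, b)
  end.

Definition act_cell (g : nat * cell) (v : cell) : cell :=
  add_cell g.2 (perm_cell g.1 v).

Definition auts : seq (nat * cell) := [seq (m, s) | m <- iota 0 6, s <- cells].

Lemma mem_auts (m : nat) (s : cell) : ((m, s) \in auts) = (m < 6).
Proof.
apply/allpairsP/idP => [[[m' s'] [Hm _ [-> _]]]|Hm].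
  by rewrite mem_iota in Hm.
by exists (m, s); split; rewrite ?mem_iota ?mem_cells.
Qed.

(** [auts] lists the 48 automorphisms of the 3-cube, each a coordinate permutation followed by a
    translation. The boolean search can be evaluated on concrete patterns. *)
Definition congruent (h p : cell -> bool) : bool :=
  has (fun g => all (fun v => p (act_cell g v) == h v) cells) auts.

Lemma congruentP (h p : cell -> bool) :
  reflect (exists2 g, g \in auts & forall v, p (act_cell g v) = h v)
          (congruent h p).
Proof.
apply: (iffP hasP) => [[g gA /all_cells H]|[g gA H]]; exists g => //.
  by move=> v; apply/eqP.
by apply/all_cells => v; apply/eqP.
Qed.

Lemma congruent_add (h p : cell -> bool) (s : cell) :
  congruent h (fun v => p (add_cell s v)) = congruent h p.
Proof.
have aux q t : congruent h (fun v => q (add_cell t v)) -> congruent h q.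
  move=> /congruentP[[m t'] gA H]; apply/congruentP; exists (m, add_cell t t').
    by rewrite mem_auts; rewrite mem_auts in gA.
  move=> v; rewrite -H /act_cell /add_cell /=; congr q.
  by rewrite !addbA.
apply/idP/idP; first exact: aux.
(* Translation by [s] is an involution, so [aux] also yields the converse. *)
move=> H; apply: (aux _ s); have -> // : (fun v => p (add_cell s (add_cell s v))) = p.
apply: funext => v; congr p; case: v => [[a b] c]; by rewrite /add_cell /= !addbA !addbb.
Qed.

(** * Frames and the subcubes they span *)

Definition frame (n : nat) := (cube n * ('I_n * 'I_n * 'I_n))%type.

(** Directions may coincide, and flips in a repeated direction then cancel. Admitting all triples
    makes sums over the directions factor. *)
Definition embed (n : nat) (u : frame n) (v : cell) : cube n :=
  let: (x, (i, j, k)) := u in let: (a, b, c) := v in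
  flip k c (flip j b (flip i a x)).

Definition proper_frame (n : nat) (u : frame n) : bool :=
  let: (x, (i, j, k)) := u in [&& i != j, i != k & j != k].

Definition pattern (n : nat) (S : {set cube n}) (u : frame n) : cell -> bool :=
  fun v => embed u v \in S.

Definition face (n : nat) (D : {set 'I_n}) (x : cube n) : {set cube n} :=
  [set y : cube n | [forall i, (i \notin D) ==> (y i == x i)]].

Definition dirs (n : nat) (u : frame n) : {set 'I_n} :=
  let: (x, (i, j, k)) := u in [set i; j; k].

Definition subcube_of (n : nat) (u : frame n) : {set cube n} := face (dirs u) u.1.

Lemma in_face (n : nat) (D : {set 'I_n}) (x y : cube n) :
  reflect (forall i, i \notin D -> y i = x i) (y \in face D x).
Proof.
rewrite inE; apply: (iffP forallP) => H i.
  by move=> iD; have := H i; rewrite iD => /eqP.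
by apply/implyP => iD; apply/eqP/H.
Qed.

Lemma face_sub (n : nat) (D : {set 'I_n}) (x y : cube n) :
  y \in face D x -> face D y = face D x.
Proof.
move/in_face => yx; apply/setP => z; apply/in_face/in_face => zx i iD.
  by rewrite zx ?yx.
by rewrite zx // yx.
Qed.

Definition coords (n : nat) (u : frame n) (y : cube n) : cell :=
  let: (x, (i, j, k)) := u in (y i (+) x i, y j (+) x j, y k (+) x k).

Lemma embedK (n : nat) (u : frame n) :
  proper_frame u -> cancel (embed u) (coords u).
Proof.
case: u => x [[i j] k] /and3P[ij ik jk] [[a b] c]; rewrite /coords !ffunE.
rewrite !eqxx (negbTE ij) (negbTE ik) (negbTE jk) !(eq_sym j) !(eq_sym k).
rewrite (negbTE ij) (negbTE ik) (negbTE jk) !andbT !andbF !addbF.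
by congr (_, _, _); rewrite addbAC addbb.
Qed.

Lemma embed_in (n : nat) (u : frame n) (v : cell) : embed u v \in subcube_of u.
Proof.
case: u v => x [[i j] k] [[a b] c]; apply/in_face => t.
rewrite !inE !negb_or => /andP[/andP[ti tj] tk].
by rewrite !ffunE (negbTE ti) (negbTE tj) (negbTE tk) !andbF !addbF.
Qed.

Lemma coordsK (n : nat) (u : frame n) :
  proper_frame u -> {in subcube_of u, cancel (coords u) (embed u)}.
Proof.
case: u => x [[i j] k] /and3P[ij ik jk] y /in_face /= yx.
apply/ffunP => t; rewrite !ffunE.
have [->|ti] := eqVneq t i.
  rewrite (negbTE ij) (negbTE ik) andbT !andbF !addbF.
  by case: (x i); case: (y i).
have [->|tj] := eqVneq t j.
  by rewrite (negbTE jk) andbT !andbF !addbF; case: (x j); case: (y j).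
have [->|tk] := eqVneq t k; first by rewrite andbT !andbF !addbF; case: (x k); case: (y k).
by rewrite !andbF !addbF yx // !inE !negb_or ti tj tk.
Qed.

Lemma subcube_ofP (n : nat) (u : frame n) (y : cube n) :
  proper_frame u -> reflect (exists v, y = embed u v) (y \in subcube_of u).
Proof.
move=> Pu; apply: (iffP idP) => [yu|[v ->]]; last exact: embed_in.
by exists (coords u y); rewrite coordsK.
Qed.

Lemma card_subcube_of (n : nat) (u : frame n) :
  proper_frame u -> #|subcube_of u| = 8.
Proof.
move=> Pu; have -> : subcube_of u = [set embed u v | v in [set: cell]].
  apply/setP => y; apply/(subcube_ofP _ Pu)/imsetP => [[v ->]|[v _ ->]].
    by exists v.
  by exists v.
rewrite card_imset; last exact: can_inj (embedK Pu).
by rewrite cardsT !card_prod card_bool.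
Qed.

Lemma card_dirs (n : nat) (u : frame n) : proper_frame u -> #|dirs u| = 3.
Proof.
case: u => x [[i j] k] /and3P[ij ik jk] /=.
rewrite finset.setUC cardsU1 cards2 !inE negb_or ij.
by rewrite (eq_sym k i) (eq_sym k j) ik jk.
Qed.

Lemma embed0 (n : nat) (u : frame n) : embed u (false, false, false) = u.1.
Proof. by case: u => x [[i j] k] /=; rewrite !flip0. Qed.

Lemma frame_in (n : nat) (u : frame n) : u.1 \in subcube_of u.
Proof. by rewrite -embed0 embed_in. Qed.

(* The directions are recovered from the subcube as the coordinates that vary
   on it. *)
Lemma subcube_of_eq (n : nat) (u w : frame n) :
  proper_frame u -> proper_frame w ->
  (subcube_of w == subcube_of u) = (w.1 \in subcube_of u) && (dirs w == dirs u).
Proof.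
move=> Pu Pw; apply/eqP/andP => [E|[wu /eqP E]]; last first.
  by rewrite /subcube_of E; apply: face_sub.
have wu : w.1 \in subcube_of u by rewrite -E frame_in.
split=> //; rewrite eqEcard !card_dirs // leqnn andbT.
apply/fintype.subsetP => t tw; apply: contraLR isT => tu.
have : flip t true w.1 \in subcube_of u.
  rewrite -E; apply/in_face => s sw; rewrite ffunE.
  by have [st|] := eqVneq s t; [rewrite st tw in sw|rewrite addbF].
move/in_face/(_ t tu); move/in_face/(_ t tu): wu => <-.
by rewrite ffunE eqxx; case: (w.1 t).
Qed.

(** The base point of [w] is a vertex of the subcube of [u], which gives the translation; the two
    frames have the same set of directions, which gives the permutation. *)
Lemma frame_aut (n : nat) (u w : frame n) :
  proper_frame u -> proper_frame w -> subcube_of w = subcube_of u ->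
  exists2 g, g \in auts & forall v, embed w v = embed u (act_cell g v).
Proof.
move=> Pu Pw /eqP; rewrite subcube_of_eq // => /andP[wu /eqP E].
have [s Es] := subcube_ofP w.1 Pu wu.
have key m : m < 6 ->
    (forall v, embed w v = embed (w.1, u.2) (perm_cell m v)) ->
    exists2 g, g \in auts & forall v, embed w v = embed u (act_cell g v).
  move=> m6 H; exists (m, s); first by rewrite mem_auts.
  move=> v; rewrite H Es /act_cell /=; case: (perm_cell m v) => [[a b] c].
  case: (u) s {Es} => x [[i j] k] [[a' b'] c'] /=; apply/ffunP => t.
  rewrite !ffunE; case: (t == i); case: (t == j); case: (t == k);
    by rewrite ?andbT ?andbF ?addbF //;
      case: (x t); case: a; case: b; case: c; case: a'; case: b'; case: c'.
case: u w Pu Pw E key {wu Es} => x [[i j] k] [y [[i' j'] k']].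
move=> /and3P[ij ik jk] /and3P[ij' ik' jk'] /= E key.
have Ei : i' \in [set i; j; k] by rewrite -E !inE eqxx.
have Ej : j' \in [set i; j; k] by rewrite -E !inE eqxx orbT.
have Ek : k' \in [set i; j; k] by rewrite -E !inE eqxx orbT.
move: Ei Ej Ek; rewrite !inE -!orbA.
(* Of the 27 placements of the new directions among the old ones, properness leaves the six
   permutations. *)
case/or3P=> /eqP Ei; case/or3P=> /eqP Ej; case/or3P=> /eqP Ek;
  subst i' j' k'; rewrite ?eqxx // in ij' ik' jk' *.
- by apply: (key 0) => // [[[a b] c]].
- by apply: (key 2) => // [[[a b] c]] /=; rewrite flipC.
- by apply: (key 1) => // [[[a b] c]] /=; rewrite [flip i b _]flipC.
- by apply: (key 5) => // [[[a b] c]] /=; rewrite flipC; congr flip; rewrite flipC.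
- by apply: (key 4) => // [[[a b] c]] /=; rewrite [flip i b _]flipC flipC.
- by apply: (key 3) => // [[[a b] c]] /=; rewrite [flip j b _]flipC flipC; congr flip; rewrite flipC.
Qed.

(** * Copies of H as congruent patterns *)

Definition adj_cell (v w : cell) : bool :=
  add_cell v w \in [:: (true, false, false); (false, true, false);
                       (false, false, true)].

Lemma act_cell_inj (g : nat * cell) : injective (act_cell g).
Proof.
case: g => m [[a b] c]; move=> [[a1 b1] c1] [[a2 b2] c2].
by do 5?[case: m => [|m]]; case=> /addbI E1 /addbI E2 /addbI E3; subst.
Qed.

Lemma adj_act_cell (g : nat * cell) (v w : cell) :
  adj_cell (act_cell g v) (act_cell g w) = adj_cell v w.
Proof.
case: g v w => m [[a b] c] [[a1 b1] c1] [[a2 b2] c2]; rewrite /adj_cell.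
have -> : add_cell (act_cell (m, (a, b, c)) (a1, b1, c1))
                   (act_cell (m, (a, b, c)) (a2, b2, c2)) =
          perm_cell m (add_cell (a1, b1, c1) (a2, b2, c2)).
  have E (p q r : bool) : p (+) q (+) (p (+) r) = q (+) r.
    by case: p; case: q; case: r.
  by do 5?[case: m => [|m]]; rewrite /act_cell /add_cell /= !E.
case: (add_cell _ _) => [[p q] r].
by do 5?[case: m => [|m]]; case: p; case: q; case: r.
Qed.

(** An edge inside the subcube runs in one of the three directions of the frame, because every other
    coordinate is constant there. *)
Lemma adj_embed (n : nat) (u : frame n) (v w : cell) :
  proper_frame u -> qadj (embed u v) (embed u w) = adj_cell v w.
Proof.
move=> Pu; have flipE s : s \in [:: (true, false, false); (false, true, false);
    (false, false, true)] -> exists i, embed u (add_cell s v) = flip i true (embed u v).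
  case: u {Pu} => x [[i j] k]; case: v => [[a b] c].
  rewrite !inE => /or3P[] /eqP->; [exists i|exists j|exists k];
  apply/ffunP => t; rewrite !ffunE /=;
  case: (t == i); case: (t == j); case: (t == k); case: (x t);
  by case: a; case: b; case: c.
apply/qadj_flip/idP => [[t Et]|vw]; last first.
  have -> : w = add_cell (add_cell v w) v.
    by case: v w {vw flipE} => [[[] []] []] [[[] []] []].
  exact: flipE.
have td : t \in dirs u.
  apply: contraLR isT => tu; have := embed_in u w; have := embed_in u v.
  move=> /in_face/(_ t tu) E1 /in_face/(_ t tu); rewrite -E1 Et ffunE eqxx.
  by case: (embed u v t).
have [s sI Es] : exists2 s, s \in [:: (true, false, false);
    (false, true, false); (false, false, true)] & flip t true (embed u v) = embed u (add_cell s v).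
  case: u td {Pu flipE Et} => x [[i j] k] /=; case: v => [[a b] c].
  rewrite !inE -orbA => /or3P[] /eqP->.
  - exists (true, false, false) => //=; apply/ffunP => t'; rewrite !ffunE.
    by case: (t' == i); case: (t' == j); case: (t' == k); case: (x t');
       case: a; case: b; case: c.
  - exists (false, true, false) => //=; apply/ffunP => t'; rewrite !ffunE.
    by case: (t' == i); case: (t' == j); case: (t' == k); case: (x t');
       case: a; case: b; case: c.
  - exists (false, false, true) => //=; apply/ffunP => t'; rewrite !ffunE.
    by case: (t' == i); case: (t' == j); case: (t' == k); case: (x t');
       case: a; case: b; case: c.
have -> : w = add_cell s v by apply: (can_inj (embedK Pu)); rewrite Et Es.
rewrite /adj_cell; suff -> : add_cell v (add_cell s v) = s by [].
by case: v s {sI Es Et flipE} => [[[] []] []] [[[] []] []].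
Qed.

(** Triples of booleans replace the points of [cube 3] in the finite checks, which then run by
    evaluation. *)
Definition ptc (v : cell) : cube 3 := pt v.1.1 v.1.2 v.2.

Definition cell_of (x : cube 3) : cell :=
  (x (@Ordinal 3 0 isT), x (@Ordinal 3 1 isT), x (@Ordinal 3 2 isT)).

Lemma ptcK : cancel ptc cell_of.
Proof. by move=> [[a b] c]; rewrite /cell_of !ffunE. Qed.

Lemma cell_ofK : cancel cell_of ptc.
Proof.
move=> x; apply/ffunP => -[[|[|[|//]]] i3]; rewrite ffunE /=; congr (x _);
  exact: val_inj.
Qed.

Lemma adj_ptc (v w : cell) : qadj (ptc v) (ptc w) = adj_cell v w.
Proof.
pose u : frame 3 := ([ffun=> false],
  (@Ordinal 3 0 isT, @Ordinal 3 1 isT, @Ordinal 3 2 isT)).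
have E s : ptc s = embed u s.
  case: s => [[a b] c]; apply/ffunP => -[[|[|[|//]]] i3];
  by rewrite !ffunE /= ?andbF ?andbT ?addbF.
by rewrite !E adj_embed.
Qed.

Definition set_cells (H : {set cube 3}) : cell -> bool := fun v => ptc v \in H.

(* A graph embedding of the 3-cube is the embedding along the frame read off
   from the image of the origin and of its three neighbours. *)
Lemma graph_embedding_frame (n : nat) (f : cell -> cube n) :
  injective f -> (forall v w, adj_cell v w = qadj (f v) (f w)) ->
  exists2 u, proper_frame u & embed u =1 f.
Proof.
move=> fI fA; pose x := f (false, false, false).
have step v w : adj_cell v w -> exists t, f w = flip t true (f v).
  by rewrite fA => /qadj_flip.
have [i Ei] := step (false, false, false) (true, false, false) isT.
have [j Ej] := step (false, false, false) (false, true, false) isT.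
have [k Ek] := step (false, false, false) (false, false, true) isT.
have ij : i != j by apply/eqP => E; move: Ei; rewrite E -Ej => /fI.
have ik : i != k by apply/eqP => E; move: Ei; rewrite E -Ek => /fI.
have jk : j != k by apply/eqP => E; move: Ej; rewrite E -Ek => /fI.
have square s t b c d e : s != t -> f b = flip s true (f e) ->
    f c = flip t true (f e) -> adj_cell b d -> adj_cell c d -> d <> e ->
    f d = flip t true (flip s true (f e)).
  move=> st Eb Ec /step[p Ep] /step[q Eq] de.
  rewrite Ep Eb; apply: (@flip_square _ s t p q) => //.
    by rewrite -Eb -Ec -Ep -Eq.
  by rewrite -Eb -Ep => /fI.
have Eij := square i j _ _ (true, true, false) _ ij Ei Ej isT isT.
have Eik := square i k _ _ (true, false, true) _ ik Ei Ek isT isT.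
have Ejk := square j k _ _ (false, true, true) _ jk Ej Ek isT isT.
have {}Eij := Eij ltac:(done); have {}Eik := Eik ltac:(done).
have {}Ejk := Ejk ltac:(done).
(* The last vertex closes the square whose other vertices are the images of 100, 110 and 101. *)
have Eijk : f (true, true, true) = flip k true (flip j true (f (true, false, false))).
  apply: (@square _ _ (true, true, false) (true, false, true)) => //.
    by rewrite Eij Ei.
  by rewrite Eik Ei.
exists (x, (i, j, k)); first by rewrite /= ij ik jk.
case=> [[[] []] []]; rewrite /= ?flip0 -/x //.
by rewrite Eijk Ei.
Qed.

(** An isomorphism onto the subcube is the embedding along some frame of it, hence differs from
    [embed u] by an element of [auts]; conversely each such element followed by [embed u] is an
    isomorphism. *)
Lemma gives_copyE (n : nat) (H : {set cube 3}) (S : {set cube n}) (u : frame n) :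
  proper_frame u ->
  gives_copy H S (subcube_of u) = congruent (set_cells H) (pattern S u).
Proof.
move=> Pu; apply/existsP/congruentP => [[f /and5P[/injectiveP fI fC fS fA fH]]|].
  have [w Pw Ew] : exists2 w, proper_frame w & embed w =1 (fun v => f (ptc v)).
    apply: graph_embedding_frame => [v v' /fI /(can_inj ptcK)//|v v'].
    by rewrite -adj_ptc; move/forallP/(_ (ptc v))/forallP/(_ (ptc v'))/eqP: fA.
  have Euw : subcube_of w = subcube_of u.
    apply/setP => y; apply/(subcube_ofP _ Pw)/idP => [[v ->]|yu].
      by rewrite Ew; move/forallP: fC; apply.
    move/forallP/(_ y): fS; rewrite yu => /existsP[z /eqP <-].
    by exists (cell_of z); rewrite Ew cell_ofK.
  have [g gA Eg] := frame_aut Pu Pw Euw; exists g => // v.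
  rewrite /pattern -Eg Ew /set_cells -(mem_imset _ _ fI) (eqP fH) inE.
  by rewrite (forallP fC) andbT.
case=> g gA Hg.
have Fi : injective (fun y => embed u (act_cell g (cell_of y))).
  by move=> y z /(can_inj (embedK Pu)) /act_cell_inj /(can_inj cell_ofK).
exists [ffun y => embed u (act_cell g (cell_of y))]; apply/and5P; split.
- by apply/injectiveP => y z; rewrite !ffunE; apply: Fi.
- by apply/forallP => y; rewrite ffunE embed_in.
- apply/forallP => y; apply/implyP => /(subcube_ofP _ Pu)[v ->].
  apply/existsP; have [h hK Kh] := injF_bij (@act_cell_inj g).
  by exists (ptc (h v)); rewrite ffunE ptcK Kh.
- apply/forallP => y; apply/forallP => z; rewrite !ffunE adj_embed //.
  by rewrite adj_act_cell -adj_ptc !cell_ofK.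
- apply/eqP/setP => y; apply/imsetP/setIP => [[z zH ->]|[yS /(subcube_ofP _ Pu)[v Ev]]].
    rewrite ffunE embed_in; split=> //.
    by have := Hg (cell_of z); rewrite /pattern /set_cells cell_ofK zH.
  have [h hK Kh] := injF_bij (@act_cell_inj g).
  exists (ptc (h v)); last by rewrite ffunE ptcK Kh.
  by have := Hg (h v); rewrite /set_cells => <-; rewrite Kh /pattern -Ev.
Qed.

Lemma is_subcubeP (n : nat) (C : {set cube n}) :
  reflect (exists2 u, proper_frame u & C = subcube_of u) (is_subcube 3 C).
Proof.
apply: (iffP existsP) => [[D /andP[/eqP D3 /existsP[a /eqP ->]]]|[u Pu ->]].
  have [i iD] : exists i, i \in D by apply/set0Pn; rewrite -card_gt0 D3.
  have /cards2P[j [k [jk ED]]] : #|D :\ i| == 2 by move: D3; rewrite (cardsD1 i D) iD => /eqP.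
  have /setP Ei := ED.
  have ij : i != j by have := Ei j; rewrite !inE eqxx eq_sym; case/andP.
  have ik : i != k by have := Ei k; rewrite !inE eqxx orbT eq_sym; case/andP.
  have {Ei}ED : D = [set i; j; k].
    by rewrite -(finset.setD1K iD) ED finset.setUA.
  exists (a, (i, j, k)); first by rewrite /= ij ik jk.
  by rewrite /subcube_of /= ED.
exists (dirs u); rewrite card_dirs // eqxx /=; apply/existsP.
by exists u.1.
Qed.

(** The base point is any of the 8 vertices, and the directions come in any of 6 orders. *)
Lemma card_frames (n : nat) (u : frame n) : proper_frame u ->
  #|[set w | proper_frame w && (subcube_of w == subcube_of u)]| = 48.
Proof.
move=> Pu; pose D := [set t : 'I_n * 'I_n * 'I_n | proper_frame (u.1, t) & dirs (u.1, t) == dirs u].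
have -> : [set w | proper_frame w && (subcube_of w == subcube_of u)] =
    finset.setX (subcube_of u) D.
  apply/setP => -[y t]; rewrite finset.in_set finset.in_setX [t \in D]finset.in_set.
  case Pw : (proper_frame (y, t)); last first.
    by case: t Pw => [[i j] k] /= ->; rewrite andbF.
  by rewrite subcube_of_eq //; case: t Pw => [[i j] k] /= ->.
rewrite cardsX card_subcube_of //; suff -> : #|D| = 6 by [].
case: u Pu @D => x [[i j] k] /and3P[ij ik jk] D.
have -> : D = [set t in [:: (i, j, k); (j, i, k); (i, k, j); (k, j, i); (j, k, i); (k, i, j)]].
  apply/setP => -[[i' j'] k']; rewrite !inE /=; apply/andP/idP.
    move=> [/and3P[ij' ik' jk'] /eqP E].
    have Ei : i' \in [set i; j; k] by rewrite -E !inE eqxx.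
    have Ej : j' \in [set i; j; k] by rewrite -E !inE eqxx orbT.
    have Ek : k' \in [set i; j; k] by rewrite -E !inE eqxx orbT.
    move: Ei Ej Ek; rewrite !inE -!orbA.
    case/or3P=> /eqP Ei; case/or3P=> /eqP Ej; case/or3P=> /eqP Ek;
      subst i' j' k'; rewrite ?eqxx ?orbT // in ij' ik' jk' *.
  move: (eq_sym i j) (eq_sym i k) (eq_sym j k) => e1 e2 e3.
  do 5?[case/orP]; case/eqP => -> -> ->; rewrite -?e1 -?e2 -?e3 ij ik jk; split=> //;
    apply/eqP/setP => t; rewrite !inE;
    by case: (t == i); case: (t == j); case: (t == k).
rewrite cardsE; apply/card_uniqP; rewrite /= !inE !xpair_eqE.
by rewrite !eqxx (eq_sym j i) (eq_sym k i) (eq_sym k j)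
  (negbTE ij) (negbTE ik) (negbTE jk) ?andbF.
Qed.

Lemma LambdaHS_frames (n : nat) (H : {set cube 3}) (S : {set cube n}) :
  48 * LambdaHS H S =
  \sum_(u : frame n | proper_frame u) congruent (set_cells H) (pattern S u).
Proof.
rewrite -big_mkcondr /=.
rewrite (partition_big (@subcube_of n)
  (fun C => is_subcube 3 C && gives_copy H S C)) /=; last first.
  move=> u /andP[Pu Hu]; rewrite gives_copyE // Hu andbT.
  by apply/is_subcubeP; exists u.
rewrite /LambdaHS -sum1dep_card big_distrr /=; apply: eq_bigr => C.
case/andP=> /is_subcubeP[u Pu ->]; rewrite gives_copyE // => Hu.
rewrite muln1 -(card_frames Pu) -sum1dep_card; apply: eq_bigl => w.
have [Pw|//] := boolP (proper_frame w).
have [E|] := eqVneq (subcube_of w) (subcube_of u); rewrite ?andbF ?andbT //=.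
by rewrite -gives_copyE // E gives_copyE.
Qed.

(** * Sums of squares over frames *)

Definition pattern_of (b0 b1 b2 b3 b4 b5 b6 b7 : bool) : cell -> bool :=
  fun v => let: (a, b, c) := v in
  if c then (if b then (if a then b7 else b6) else if a then b5 else b4)
  else if b then (if a then b3 else b2) else if a then b1 else b0.

Definition allb (P : bool -> bool) : bool := P false && P true.

Lemma allbP (P : bool -> bool) : allb P -> forall b, P b.
Proof. by move=> /andP[? ?] []. Qed.

Definition all_patterns (P : (cell -> bool) -> bool) : bool :=
  allb (fun b0 => allb (fun b1 => allb (fun b2 => allb (fun b3 =>
  allb (fun b4 => allb (fun b5 => allb (fun b6 => allb (fun b7 =>
    P (pattern_of b0 b1 b2 b3 b4 b5 b6 b7))))))))).

(* Tabulating a pattern makes repeated evaluations of it cheap. *)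
Definition tabulate (p : cell -> bool) : cell -> bool :=
  pattern_of (p (false, false, false)) (p (true, false, false))
    (p (false, true, false)) (p (true, true, false)) (p (false, false, true))
    (p (true, false, true)) (p (false, true, true)) (p (true, true, true)).

Lemma tabulateE (p : cell -> bool) : tabulate p = p.
Proof. by apply: funext => -[[[] []] []]. Qed.

Lemma all_patternsP (P : (cell -> bool) -> bool) :
  all_patterns P -> forall p, P p.
Proof.
move=> H p; rewrite -(tabulateE p).
have key b0 b1 b2 b3 b4 b5 b6 b7 : P (pattern_of b0 b1 b2 b3 b4 b5 b6 b7).
  by move: H => /allbP/(_ b0)/allbP/(_ b1)/allbP/(_ b2)/allbP/(_ b3)
    /allbP/(_ b4)/allbP/(_ b5)/allbP/(_ b6)/allbP/(_ b7).
exact: key.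
Qed.

Definition rot_cell (v : cell) : cell := let: (a, b, c) := v in (c, a, b).

(** Moving the base point of a frame to its vertex [s] is an involution on all frames, degenerate
    ones included. *)
Lemma sum_pattern_add (n : nat) (S : {set cube n}) (s : cell)
    (F : (cell -> bool) -> Z) :
  (\sum_u F (fun v => pattern S u (add_cell s v)) = \sum_u F (pattern S u))%R.
Proof.
have embE u v : embed (embed u s, u.2) v = embed u (add_cell s v).
  case: u s v => x [[i j] k] [[a b] c] [[a' b'] c'] /=; apply/ffunP => t.
  rewrite !ffunE; case: (t == i); case: (t == j); case: (t == k);
    by rewrite ?andbT ?andbF ?addbF //;
      case: (x t); case: a; case: b; case: c; case: a'; case: b'; case: c'.
have inv : involutive (fun u : frame n => (embed u s, u.2)).
  move=> [x t]; congr pair; rewrite embE.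
  have -> : add_cell s s = (false, false, false) by case: s {embE} => [[[] []] []].
  exact: embed0.
rewrite [RHS](reindex_inj (inv_inj inv)); apply: eq_bigr => u _; congr F.
by apply: funext => v; rewrite /pattern embE.
Qed.

Lemma sum_pattern_rot (n : nat) (S : {set cube n}) (F : (cell -> bool) -> Z) :
  (\sum_u F (fun v => pattern S u (rot_cell v)) = \sum_u F (pattern S u))%R.
Proof.
pose h (u : frame n) : frame n := let: (x, (i, j, k)) := u in (x, (j, k, i)).
have hI : injective h by move=> [x [[i j] k]] [y [[i' j'] k']] [-> -> -> ->].
rewrite [RHS](reindex_inj hI); apply: eq_bigr => -[x [[i j] k]] _; congr F.
apply: funext => -[[a b] c]; rewrite /pattern /=.
by rewrite (flipC j i) (flipC k i).
Qed.

(** A weight, the prescribed colours of the edge from [x] in direction [i], and the values of a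
    linear form on the colours 00, 10, 01, 11 of a parallel edge. *)
Definition square_term := (Z * (bool * bool) * (Z * Z * Z * Z))%type.

(* The linear form [l] is evaluated at a direction through the colours of the
   two ends of the parallel edge; the product below is the generic term of the
   square of its sum over all directions. *)
Definition form_at (l : Z * Z * Z * Z) (a b : bool) : Z :=
  let: (l00, l10, l01, l11) := l in
  if a then (if b then l11 else l10) else if b then l01 else l00.

Definition square_at (t : square_term) (p : cell -> bool) : Z :=
  let: (c, (a, b), l) := t in
  if (p (false, false, false) == a) && (p (true, false, false) == b)
  then (c * (form_at l (p (false, true, false)) (p (true, true, false)) *
             form_at l (p (false, false, true)) (p (true, false, true))))%BZ
  else 0%BZ.

Definition squares_at (ts : seq square_term) (p : cell -> bool) : Z :=
  foldr (fun t z => square_at t p + z)%BZ 0%BZ ts.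

Lemma sum_frame (n : nat) (F : frame n -> Z) :
  (\sum_u F u = \sum_x \sum_i \sum_j \sum_k F (x, (i, j, k)))%R.
Proof.
rewrite [RHS](_ : _ = \sum_x \sum_t F (x, t))%R.
  by rewrite pair_big /=; apply: eq_bigr => -[].
apply: eq_bigr => x _.
under eq_bigr do rewrite pair_big /=.
rewrite pair_big /= (reindex (fun t : 'I_n * 'I_n * 'I_n => (t.1.1, (t.1.2, t.2)))) /=.
  by apply: eq_bigr => -[[i j] k].
by exists (fun t => (t.1, t.2.1, t.2.2)) => [[[i j] k]|[i [j k]]].
Qed.

(** For fixed [x] and [i] the colour test does not involve [j] and [k], so the double sum over these
    is [c] times the square of [\sum_j L j]. *)
Lemma sum_square_ge0 (n : nat) (S : {set cube n}) (t : square_term) :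
  (0 <= t.1.1)%BZ -> (0 <= \sum_u square_at t (pattern S u))%R.
Proof.
case: t => [[c [a b]] l] /= c0; rewrite sum_frame.
apply: sumr_ge0 => x _; apply: sumr_ge0 => i _.
pose L j := form_at l (flip j true x \in S) (flip j true (flip i true x) \in S).
rewrite (_ : (\sum_j _ = if ((x \in S) == a) && ((flip i true x \in S) == b)
  then c * (\sum_j L j) ^+ 2 else 0)%R).
  by case: ifP => // _; apply: mulr_ge0; [apply/Z.leb_le|apply: sqr_ge0].
rewrite /pattern /= !flip0.
case: ifP => E; last by rewrite !big1 // => j _; rewrite !big1 // => k _; rewrite !flip0 E.
rewrite expr2 big_distrlr /= big_distrr; apply: eq_bigr => j _.
rewrite big_distrr; apply: eq_bigr => k _ /=.
by rewrite !flip0 E.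
Qed.

Lemma sum_squares_ge0 (n : nat) (S : {set cube n}) (ts : seq square_term) :
  all (fun t => 0 <=? t.1.1)%BZ ts -> (0 <= \sum_u squares_at ts (pattern S u))%R.
Proof.
elim: ts => [_|t ts IH /andP[/Z.leb_le t0 /IH {}IH]]; first by rewrite big1.
by rewrite big_split /=; apply: addr_ge0 => //; apply: sum_square_ge0.
Qed.

Definition rotations (p : cell -> bool) : seq (cell -> bool) :=
  [:: p; fun v => p (rot_cell v); fun v => p (rot_cell (rot_cell v))].

(** Eight translations and three rotations give 24 of the 48 symmetries; the other 24 would repeat
    the same values, as [square_at] is symmetric in the last two directions. *)
Definition symmetrized (ts : seq square_term) (p : cell -> bool) : Z :=
  foldr (fun s z => foldr (fun q z => squares_at ts q + z)%BZ z
    (rotations (fun v => p (add_cell s v)))) 0%BZ cells.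

Lemma sum_symmetrized_ge0 (n : nat) (S : {set cube n}) (ts : seq square_term) :
  all (fun t => 0 <=? t.1.1)%BZ ts -> (0 <= \sum_u symmetrized ts (pattern S u))%R.
Proof.
move=> /(sum_squares_ge0 S) H; rewrite /symmetrized.
elim: cells => [|s r IH]; first by rewrite big1.
rewrite /= !big_split /=.
rewrite (sum_pattern_add S s (fun p => squares_at ts (fun v => p (rot_cell (rot_cell v))))).
rewrite (sum_pattern_add S s (fun p => squares_at ts (fun v => p (rot_cell v)))).
rewrite (sum_pattern_add S s (squares_at ts)).
rewrite (sum_pattern_rot S (fun p => squares_at ts (fun v => p (rot_cell v)))).
rewrite (sum_pattern_rot S (squares_at ts)).
by do 3![apply: addr_ge0 => //].
Qed.

(** The factor 24 matches the number of terms in [symmetrized]; averaged over frames, the inequality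
    bounds the density of congruent patterns by [d / c]. *)
Definition certified (h : cell -> bool) (c d : nat) (ts : seq square_term) : bool :=
  all_patterns (fun p => Z.leb (Z.add (symmetrized ts p)
    (if congruent h p then Z.mul 24 (Z.of_nat c) else Z0)) (Z.mul 24 (Z.of_nat d))).

Lemma card_frame (n : nat) : #|{: frame n}| = 2 ^ n * n ^ 3.
Proof. by rewrite !card_prod card_ffun card_bool !card_ord !expnS expn0 muln1 !mulnA. Qed.

Lemma certified_bound (n c d : nat) (H : {set cube 3}) (S : {set cube n})
    (ts : seq square_term) :
  all (fun t => 0 <=? t.1.1)%BZ ts -> certified (set_cells H) c d ts ->
  c * (48 * LambdaHS H S) <= d * (2 ^ n * n ^ 3).
Proof.
move=> /(sum_symmetrized_ge0 S) Hts /all_patternsP Hc.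
(* Degenerate frames enter the count as well, which can only increase it. *)
apply: leq_trans (_ : c * \sum_u congruent (set_cells H) (pattern S u) <= _).
  rewrite leq_mul2l LambdaHS_frames big_mkcond /=; apply/orP; right.
  by apply: leq_sum => u _; case: ifP.
pose f m := Z.mul 24 (Z.of_nat m).
have fsum (F : frame n -> nat) : (\sum_u f (F u))%R = f (\sum_u F u).
  apply/esym/(@big_morph _ _ _ 0%R +%R) => // x y.
  by rewrite -[RHS]/(Z.add _ _) /f; lia.
have : (\sum_u symmetrized ts (pattern S u) +
        \sum_u f (c * congruent (set_cells H) (pattern S u)) <=
        \sum_(u : frame n) f d)%R.
  rewrite -big_split /=; apply: ler_sum => u _.
  apply/Z.leb_le; have /Z.leb_le := Hc (pattern S u).
  by rewrite -[(_ + _)%R]/(Z.add _ _) /f; case: ifP => _; lia.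
rewrite !fsum sum_nat_const card_frame -big_distrr /= => /Z.leb_le.
move/Z.leb_le: Hts; rewrite -[(_ + _)%R]/(Z.add _ _) -[0%R]/Z0 /f.
move: (\sum_u _)%R (\sum_u _)%N => A B; lia.
Qed.

(** * Certificates for [W7], [W9], [W10] and [W12] *)

(** At an edge outside [S], the form compares the directions whose parallel edge meets [S] only over
    [x] with those where it meets [S] only over the other end. *)
Definition squares7 : seq square_term :=
  [:: (4, (false, false), (0, 1, -1, 0))]%BZ.

Definition squares9 : seq square_term :=
  [:: (7, (false, false), (1, 2, 2, -4));
      (7, (true, true), (-4, 2, 2, 1));
      (8, (true, false), (1, 4, -2, 1))]%BZ.

Definition squares10 : seq square_term :=
  [:: (106, (false, false), (0, 1, -1, 0));
      (1, (false, false), (5, 3, 3, -17));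
      (1, (true, true), (1, 0, 0, -5));
      (40, (true, false), (1, 1, -1, -1));
      (50, (true, false), (1, -2, 0, 0));
      (10, (true, false), (0, 3, -1, 0))]%BZ.

(** At an edge leaving [S], the form compares the directions whose parallel edge lies outside [S]
    with those where it lies inside. *)
Definition squares12 : seq square_term :=
  [:: (4, (true, false), (1, 0, 0, -1))]%BZ.

Definition seq_cells (vs : seq cell) : cell -> bool := fun v => v \in vs.

Definition cells7 : seq cell := [:: (false, false, false); (true, true, true)].
Definition cells8 : seq cell :=
  [:: (false, false, true); (false, true, false); (true, false, false)].
Definition cells9 : seq cell :=
  [:: (false, false, false); (false, false, true); (false, true, false);
      (true, true, true)].
Definition cells10 : seq cell :=
  [:: (false, false, false); (false, false, true); (true, true, true)].
Definition cells12 : seq cell :=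
  [:: (false, false, false); (false, false, true); (false, true, false);
      (true, false, false)].

Lemma set_cells_W :
  [/\ set_cells W7 = seq_cells cells7, set_cells W8 = seq_cells cells8,
      set_cells W9 = seq_cells cells9, set_cells W10 = seq_cells cells10 &
      set_cells W12 = seq_cells cells12].
Proof.
split; apply: funext => v; rewrite /set_cells /seq_cells !inE;
  by rewrite !(can2_eq ptcK cell_ofK) /cell_of !ffunE -?orbA.
Qed.

Lemma certified7 : certified (seq_cells cells7) 3 1 squares7.
Proof. by lazy. Qed.
(** 16/36 is 4/9, and 25/60 below is 5/12; the scaling keeps the weights of the squares integral. *)
Lemma certified9 : certified (seq_cells cells9) 36 16 squares9.
Proof. by vm_compute. Qed.
Lemma certified10 : certified (seq_cells cells10) 60 25 squares10.
Proof. by vm_compute. Qed.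
Lemma certified12 : certified (seq_cells cells12) 2 1 squares12.
Proof. by vm_compute. Qed.

(** * The bound for W8 *)

Notation cell4 := (cell * bool)%type.

(** The fourth direction moves the base point, so the cells with last entry [false] carry the
    pattern of the frame itself. *)
Definition pattern4 (n : nat) (S : {set cube n}) (w : frame n * 'I_n) :
    cell4 -> bool :=
  fun v => embed (flip w.2 v.2 w.1.1, w.1.2) v.1 \in S.

Definition sum_invariant (n : nat) (S : {set cube n}) (r : cell4 -> cell4) : Prop :=
  forall F : (cell4 -> bool) -> Z,
  (\sum_w F (fun v => pattern4 S w (r v)) = \sum_w F (pattern4 S w))%R.

Definition flip4 (v : cell4) : cell4 := (v.1, ~~ v.2).
Definition rot4 (v : cell4) : cell4 :=
  let: (a, b, c, d) := v in (d, a, b, c).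
Definition swap4 (v : cell4) : cell4 :=
  let: (a, b, c, d) := v in (a, c, b, d).

Lemma sum_invariant_comp (n : nat) (S : {set cube n}) (r r' : cell4 -> cell4) :
  sum_invariant S r -> sum_invariant S r' -> sum_invariant S (r \o r').
Proof.
by move=> rI rI' F; rewrite (rI (fun p => F (fun v => p (r' v)))) rI'.
Qed.

Lemma sum_invariant_flip4 (n : nat) (S : {set cube n}) : sum_invariant S flip4.
Proof.
move=> F; pose h (w : frame n * 'I_n) : frame n * 'I_n :=
  (flip w.2 true w.1.1, w.1.2, w.2).
have hI : injective h by apply: inv_inj => -[[x t] l]; rewrite /h /= flipK.
rewrite [RHS](reindex_inj hI); apply: eq_bigr => -[[x t] l] _; congr F.
by apply: funext => -[v d]; rewrite /pattern4 /= flip_add addbT.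
Qed.

Lemma sum_invariant_rot4 (n : nat) (S : {set cube n}) : sum_invariant S rot4.
Proof.
move=> F; pose h (w : frame n * 'I_n) : frame n * 'I_n :=
  let: (x, (i, j, k), l) := w in (x, (j, k, l), i).
have hI : injective h.
  by move=> [[x [[i j] k]] l] [[y [[i' j'] k']] l'] [-> -> -> -> ->].
rewrite [RHS](reindex_inj hI); apply: eq_bigr => -[[x [[i j] k]] l] _; congr F.
apply: funext => -[[[a b] c] d]; rewrite /pattern4 /=.
by rewrite (flipC i l) (flipC j l) (flipC k l).
Qed.

Lemma sum_invariant_swap4 (n : nat) (S : {set cube n}) : sum_invariant S swap4.
Proof.
move=> F; pose h (w : frame n * 'I_n) : frame n * 'I_n :=
  let: (x, (i, j, k), l) := w in (x, (i, k, j), l).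
have hI : injective h.
  by move=> [[x [[i j] k]] l] [[y [[i' j'] k']] l'] [-> -> -> -> ->].
rewrite [RHS](reindex_inj hI); apply: eq_bigr => -[[x [[i j] k]] l] _; congr F.
by apply: funext => -[[[a b] c] d]; rewrite /pattern4 /= (flipC j k).
Qed.

Definition rotations4 : seq (cell4 -> cell4) :=
  [:: id; rot4; rot4 \o rot4; rot4 \o (rot4 \o rot4)].

(** These carry the facet with last coordinate 0 to each of the 8 facets of the 4-cube. *)
Definition facet_auts : seq (cell4 -> cell4) :=
  rotations4 ++ [seq r \o flip4 | r <- rotations4].

(** [rs] realises the 6 pairs of free directions of a square face, [flip4] and its conjugate by
    [rot4] the 4 values of the fixed coordinates: one symmetry for each of the 24 square faces. *)
Definition face_auts : seq (cell4 -> cell4) :=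
  let rs := rotations4 ++ [:: swap4; rot4 \o swap4] in
  let rs' := rs ++ [seq r \o flip4 | r <- rs] in
  rs' ++ [seq r \o (rot4 \o (rot4 \o (rot4 \o (flip4 \o rot4)))) | r <- rs'].

Lemma all_sum_invariant (n : nat) (S : {set cube n}) :
  (forall r, List.In r facet_auts -> sum_invariant S r) /\
  (forall r, List.In r face_auts -> sum_invariant S r).
Proof.
have inv_id : sum_invariant S id by [].
split=> r /=; intuition; subst r;
  repeat first [exact: inv_id | exact: sum_invariant_flip4
    | exact: sum_invariant_rot4 | exact: sum_invariant_swap4
    | apply: sum_invariant_comp].
Qed.

(** A copy of [W8] consists of three of the four vertices of one parity and none of the other
    parity. *)
Definition is_W8 (p : cell -> bool) : bool :=
  let three a b c d := if a then (if b then c (+) d else c && d) else [&& b, c & d] in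
  let none a b c d := if a then false else if b then false else if c then false else ~~ d in
  if none (p (false, false, false)) (p (true, true, false))
          (p (true, false, true)) (p (false, true, true))
  then three (p (true, false, false)) (p (false, true, false))
             (p (false, false, true)) (p (true, true, true))
  else if none (p (true, false, false)) (p (false, true, false))
               (p (false, false, true)) (p (true, true, true))
  then three (p (false, false, false)) (p (true, true, false))
             (p (true, false, true)) (p (false, true, true))
  else false.

Lemma is_W8E (p : cell -> bool) : congruent (seq_cells cells8) p = is_W8 p.
Proof. by apply/eqP; move: p; apply: all_patternsP; vm_compute. Qed.

(* For a square that meets [S] in a diagonal ([f00] says which one), the sign
   tells over which of its two vertices outside [S] the parallel square [g] has
   its only vertex in [S]. *)
Definition side (f00 g00 g10 g01 g11 : bool) : Z :=
  if f00 then
    if g00 || g11 then 0%BZ else if g10 then (if g01 then 0 else 1)%BZ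
    else if g01 then (-1)%BZ else 0%BZ
  else
    if g10 || g01 then 0%BZ else if g00 then (if g11 then 0 else 1)%BZ
    else if g11 then (-1)%BZ else 0%BZ.

Definition diagonal (f00 f10 f01 f11 : bool) : bool :=
  if f00 then (if f10 then false else if f01 then false else f11)
  else if f10 then (if f01 then ~~ f11 else false) else false.

Definition side_product (p : cell4 -> bool) : Z :=
  let f00 := p (false, false, false, false) in
  if diagonal f00 (p (true, false, false, false))
       (p (false, true, false, false)) (p (true, true, false, false))
  then Z.mul
    (side f00 (p (false, false, true, false)) (p (true, false, true, false))
              (p (false, true, true, false)) (p (true, true, true, false)))
    (side f00 (p (false, false, false, true)) (p (true, false, false, true))
              (p (false, true, false, true)) (p (true, true, false, true)))
  else Z0.

Definition pattern4_of (q q' : cell -> bool) : cell4 -> bool :=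
  fun v => if v.2 then q' v.1 else q v.1.

Definition aut_sum (rs : seq (cell4 -> cell4)) (F : (cell4 -> bool) -> Z)
    (p : cell4 -> bool) : Z :=
  foldr (fun r z => Z.add (F (fun v => p (r v))) z) Z0 rs.

Definition facet_W8 (p : cell4 -> bool) : Z :=
  if is_W8 (fun v => p (v, false)) then 1%BZ else Z0.

(** On average the first sum is 8 times the density of copies and the second is nonnegative, so 72
    times the density is at most 48. *)
Definition W8_inequality (p : cell4 -> bool) : bool :=
  Z.leb (Z.add (Z.mul 9 (aut_sum facet_auts facet_W8 p))
               (Z.mul 2 (aut_sum face_auts side_product p))) 48.

Lemma W8_inequality_pattern4_of :
  all_patterns (fun q => all_patterns (fun q' => W8_inequality (pattern4_of q q'))).
Proof. by vm_compute. Qed.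

Lemma W8_inequality_all (p : cell4 -> bool) : W8_inequality p.
Proof.
have -> : p = pattern4_of (fun v => p (v, false)) (fun v => p (v, true)).
  by apply: funext => -[v []].
have key (P : (cell -> bool) -> (cell -> bool) -> bool) :
    all_patterns (fun q => all_patterns (fun q' => P q q')) -> forall q q', P q q'.
  by move=> H q; apply: all_patternsP; move: q; apply: all_patternsP.
exact: (key _ W8_inequality_pattern4_of).
Qed.

Lemma sum_aut_sum (n : nat) (S : {set cube n}) (rs : seq (cell4 -> cell4))
    (F : (cell4 -> bool) -> Z) :
  (forall r, List.In r rs -> sum_invariant S r) ->
  (\sum_w aut_sum rs F (pattern4 S w) = (\sum_w F (pattern4 S w)) *+ size rs)%R.
Proof.
elim: rs => [|r rs IH] H; first by rewrite big1 ?mulr0n.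
rewrite big_split /= mulrS H; last by left.
by rewrite -IH // => r' r'I; apply: H; right.
Qed.

(** For fixed [x], [i], [j] the diagonal test is independent of [k] and [l], and the sum over these
    is the square of [\sum_k L k]. *)
Lemma sum_side_product_ge0 (n : nat) (S : {set cube n}) :
  (0 <= \sum_w side_product (pattern4 S w))%R.
Proof.
rewrite (_ : (\sum_w _)%R =
    \sum_(u : frame n) \sum_l side_product (pattern4 S (u, l)))%R; last first.
  by rewrite pair_big /=; apply: eq_bigr => -[].
rewrite sum_frame; apply: sumr_ge0 => x _; apply: sumr_ge0 => i _.
apply: sumr_ge0 => j _.
pose f a b := flip j b (flip i a x) \in S.
pose g k a b := flip k true (flip j b (flip i a x)) \in S.
pose L k := side (f false false) (g k false false) (g k true false)
  (g k false true) (g k true true).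
rewrite (_ : (\sum_k _)%R = if diagonal (f false false) (f true false)
  (f false true) (f true true) then ((\sum_k L k) ^+ 2)%R else 0%R).
  by case: ifP => // _; apply: sqr_ge0.
have E k l : side_product (pattern4 S (x, (i, j, k), l)) =
  if diagonal (f false false) (f true false) (f false true) (f true true)
  then Z.mul (L k) (L l) else Z0.
  rewrite /side_product /pattern4 /L /f /g /= !flip0.
  by rewrite !(flipC i l) !(flipC j l).
case: ifP => D; last by rewrite big1 // => k _; rewrite big1 // => l _; rewrite E D.
rewrite expr2 big_distrlr /=; apply: eq_bigr => k _; apply: eq_bigr => l _.
by rewrite E D.
Qed.

Lemma W8_bound (n : nat) (S : {set cube n}) :
  3 * (48 * LambdaHS W8 S) <= 2 * (2 ^ n * n ^ 3).
Proof.
pose c (u : frame n) := congruent (set_cells W8) (pattern S u) : nat.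
apply: (@leq_trans (3 * \sum_u c u)).
  rewrite leq_mul2l LambdaHS_frames big_mkcond /=.
  by apply: leq_sum => u _; rewrite /c; case: ifP.
have [I1 I2] := all_sum_invariant S.
have H : (\sum_w Z.add (Z.mul 9 (aut_sum facet_auts facet_W8 (pattern4 S w)))
           (Z.mul 2 (aut_sum face_auts side_product (pattern4 S w))) <=
         \sum_(w : frame n * 'I_n) 48%BZ)%R.
  by apply: ler_sum => w _; apply: W8_inequality_all.
have E : (\sum_w facet_W8 (pattern4 S w))%R = Z.of_nat (n * \sum_u c u).
  have -> : n * \sum_u c u = \sum_(w : frame n * 'I_n) c w.1.
    rewrite -(pair_big xpredT xpredT (fun u _ => c u)) /= big_distrr.
    by apply: eq_bigr => u _; rewrite sum_nat_const card_ord.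
  apply/esym; rewrite (@big_morph _ _ Z.of_nat 0%R +%R) // => [|a b]; last first.
    by rewrite Nat2Z.inj_add.
  apply: eq_bigr => -[[x t] l] _ /=.
  rewrite /facet_W8 /pattern4 /= flip0 -is_W8E /c.
  have [_ -> _ _ _] := set_cells_W.
  by rewrite -/(pattern S (x, t)); case: ifP.
have mulE z (F : frame n * 'I_n -> Z) :
    (\sum_w Z.mul z (F w))%R = Z.mul z (\sum_w F w)%R.
  by rewrite -[RHS]/(z * _)%R big_distrr.
have mulrnZ (z : Z) m : (z *+ m)%R = Z.mul z (Z.of_nat m).
  elim: m => [|m IH]; first by rewrite mulr0n; lia.
  by rewrite mulrS IH -[(_ + _)%R]/(Z.add _ _); lia.
move: H (sum_side_product_ge0 S); rewrite big_split !mulE !sum_aut_sum // E.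
rewrite sumr_const card_prod card_frame card_ord !mulrnZ.
rewrite -[size facet_auts]/8 -[size face_auts]/24.
move: (\sum_w side_product _)%R => A /Z.leb_le H1 /Z.leb_le H2.
have {}H1 : Z.le (Z.add (Z.mul 9 (Z.mul (Z.of_nat (n * \sum_u c u)) 8))
  (Z.mul 2 (Z.mul A 24))) (Z.mul 48 (Z.of_nat (2 ^ n * n ^ 3 * n))) := H1.
have {}H2 : Z.le Z0 A := H2.
(* The factor [n] from the fourth direction is cancelled; for [n = 0] there are no frames. *)
have [n0|n0] := posnP n.
  by rewrite (big1 _ xpredT) // => -[x [[i j] k]] _; have := ltn_ord i; rewrite {2}n0.
rewrite -(leq_pmul2l n0); move: (\sum_u c u) (2 ^ n * n ^ 3) H1 => B X H1.
lia.
Qed.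

(** * Sets defined by weights in a finite abelian group *)

Definition weight (K : zmodType) (q : nat) (d : nat -> K) (n : nat) (x : cube n) : K :=
  (\sum_(t < n) if x t then d (t %% q)%N else 0)%R.

Definition weight_set (K : zmodType) (q : nat) (d : nat -> K) (T : K -> bool)
    (n : nat) (c : K) : {set cube n} :=
  [set x | T (c + weight q d x)%R].

Definition group_pattern (K : zmodType) (T : K -> bool) (c a b e : K) :
    cell -> bool :=
  fun v => T (c + (if v.1.1 then a else 0) + (if v.1.2 then b else 0)
              + (if v.2 then e else 0))%R.

Definition good_shifts (K : zmodType) (cs : seq K) (d : nat -> K) (T : K -> bool)
    (h : cell -> bool) (a b e : nat) : nat :=
  count (fun c => congruent h (tabulate (group_pattern T c (d a) (d b) (d e)))) cs.

Lemma weight_flip (K : zmodType) (q : nat) (d : nat -> K) (n : nat)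
    (x : cube n) (i : 'I_n) (a : bool) : x i = false ->
  weight q d (flip i a x) = (weight q d x + if a then d (i %% q)%N else 0)%R.
Proof.
move=> xi; rewrite /weight (bigD1 i) //= [in RHS](bigD1 i) //= ffunE eqxx xi.
rewrite andbT add0r addrC; congr (_ + _)%R; apply: eq_bigr => t ti.
by rewrite ffunE (negbTE ti) andbF addbF.
Qed.

(** As [c] runs through the group, so does [c] plus the weight of the base point; hence the count
    depends only on the classes of the three directions. *)
Lemma count_weight_set (K : zmodType) (cs : seq K) (q : nat) (d : nat -> K)
    (T : K -> bool) (h : cell -> bool) (n : nat) (u : frame n) :
  uniq cs -> (forall c, c \in cs) -> proper_frame u ->
  \sum_(c <- cs) congruent h (pattern (weight_set q d T n c) u) =
  good_shifts cs d T h (u.2.1.1 %% q) (u.2.1.2 %% q) (u.2.2 %% q).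
Proof.
move=> csU csF; case: u => x [[i j] k] /= /and3P[ij ik jk].
pose s := (x i, x j, x k).
(* The base point is moved to the vertex of the subcube where the three coordinates vanish, so that
   each flip adds its step to the weight. *)
have [y [Ey yi yj yk]] : exists y, [/\ y = embed (x, (i, j, k)) s,
    y i = false, y j = false & y k = false].
  exists (embed (x, (i, j, k)) s); rewrite !ffunE !eqxx (negbTE ij) (negbTE ik) (negbTE jk).
  rewrite (eq_sym j) (eq_sym k i) (eq_sym k j) (negbTE ij) (negbTE ik) (negbTE jk).
  by rewrite !andbT !andbF !addbF !addbb.
have E c : congruent h (pattern (weight_set q d T n c) (x, (i, j, k))) =
    congruent h (group_pattern T (c + weight q d y)%R (d (i %% q)%N) (d (j %% q)%N) (d (k %% q)%N)).
  rewrite -[RHS](congruent_add _ _ s); congr congruent.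
  apply: funext => v; rewrite /pattern inE /group_pattern -!addrA; congr T.
  congr (_ + _)%R.
  have -> : embed (x, (i, j, k)) v = embed (y, (i, j, k)) (add_cell s v).
    rewrite Ey; case: v s {y Ey yi yj yk} => [[a b] c'] [[a' b'] c''] /=.
    apply/ffunP => t; rewrite !ffunE; case: (t == i); case: (t == j); case: (t == k);
    by rewrite ?andbT ?andbF ?addbF //; case: (x t); case: a; case: b;
      case: c'; case: a'; case: b'; case: c''.
  case: (add_cell s v) => [[a b] e] /=.
  have Hj : flip i a y j = false.
    by rewrite ffunE yj (eq_sym j) (negbTE ij) andbF.
  have Hk : flip j b (flip i a y) k = false.
    by rewrite ffunE [flip i a y k]ffunE yk (eq_sym k i) (eq_sym k j) (negbTE ik) (negbTE jk) !andbF.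
  by rewrite !weight_flip // !addrA.
under eq_bigr do rewrite E.
rewrite /good_shifts -sum1_count [RHS]big_mkcond /= [RHS](perm_big [seq (c + weight q d y)%R | c <- cs]).
  by rewrite big_map /=; apply: eq_bigr => c _; rewrite tabulateE; case: (congruent _ _).
apply: uniq_perm => //; first by rewrite map_inj_uniq //; apply: addIr.
move=> c; rewrite csF; apply/esym/mapP; exists (c - weight q d y)%R => //.
by rewrite subrK.
Qed.

(** Complete periods contribute equally, and the incomplete last one is dropped. *)
Lemma sum_modn (q n : nat) (F : nat -> nat) :
  n %/ q * sumn [seq F a | a <- iota 0 q] <= \sum_(i < n) F (i %% q).
Proof.
case: q => [|q]; first by rewrite divn0.
rewrite sumnE big_map.
have key m : m * \sum_(a <- iota 0 q.+1) F a = \sum_(0 <= i < m * q.+1) F (i %% q.+1).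
  elim: m => [|m IH]; first by rewrite !mul0n big_geq.
  rewrite mulSn IH [m.+1 * q.+1]mulSn [q.+1 + _]addnC addnC.
  rewrite (@big_cat_nat _ _ _ (m * q.+1) 0 (m * q.+1 + q.+1)) ?leq_addr //.
  congr (_ + _); rewrite -{1}[m * q.+1]add0n big_addn addKn /index_iota subn0.
  by apply: eq_big_seq => a; rewrite mem_iota add0n => /andP[_ aq]; rewrite addnC modnMDl modn_small.
rewrite key -(big_mkord xpredT (fun i => F (i %% q.+1))).
by rewrite [leqRHS](@big_cat_nat _ _ _ (n %/ q.+1 * q.+1)) ?leq_trunc_div //= leq_addr.
Qed.

(** The counts for the translates of [T] are summed, and each is at most the maximum; the error term
    accounts for triples with a repeated direction. *)
Lemma weight_set_bound (K : zmodType) (cs : seq K) (q : nat) (d : nat -> K)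
    (T : K -> bool) (H : {set cube 3}) (n : nat) :
  uniq cs -> (forall c, c \in cs) ->
  (n %/ q) ^ 3 * sumn [seq sumn [seq sumn
    [seq good_shifts cs d T (set_cells H) a b e | e <- iota 0 q]
      | b <- iota 0 q] | a <- iota 0 q] * 2 ^ n <=
  size cs * (48 * LambdaHn n H + 3 * n ^ 2 * 2 ^ n).
Proof.
move=> csU csF; pose N := good_shifts cs d T (set_cells H).
pose NN := \sum_(i < n) \sum_(j < n) \sum_(k < n) N (i %% q) (j %% q) (k %% q).
apply: (@leq_trans (NN * 2 ^ n)).
  rewrite leq_mul2r; apply/orP; right; rewrite expnS expnS expn1 -!mulnA.
  apply: leq_trans (leq_trans _ (sum_modn q n (fun a => n %/ q * (n %/ q *
    sumn [seq sumn [seq N a b e | e <- iota 0 q] | b <- iota 0 q])))) _.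
    rewrite leq_mul2l; apply/orP; right.
    rewrite !sumnE !big_map !big_distrr /=; apply: leq_sum => a _.
    by rewrite !sumnE !big_map !big_distrr.
  apply: leq_sum => i _.
  apply: leq_trans (leq_trans _ (sum_modn q n (fun b => n %/ q *
    sumn [seq N (i %% q) b e | e <- iota 0 q]))) _.
    rewrite leq_mul2l; apply/orP; right.
    by rewrite !sumnE !big_map !big_distrr.
  by apply: leq_sum => j _; apply: sum_modn.
have NS a b e : N a b e <= size cs by apply: count_size.
pose P (i j k : 'I_n) := [&& i != j, i != k & j != k].
pose NP := \sum_(i < n) \sum_(j < n) \sum_(k < n)
  (if P i j k then N (i %% q) (j %% q) (k %% q) else 0).
(* Each of the three coincidences holds for [n ^ 2] triples, and a triple contributes at most
   [size cs]. *)
have diag : NN <= NP + size cs * (3 * n ^ 2).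
  have -> : 3 * n ^ 2 = \sum_(i < n) \sum_(j < n) \sum_(k < n)
      ((i == j) + (i == k) + (j == k)).
    have E (i : 'I_n) : \sum_(k < n) (i == k) = 1.
      rewrite (bigD1 i) //= eqxx big1 ?addn0 // => k ki.
      by rewrite eq_sym (negbTE ki).
    under eq_bigr => i _ do under eq_bigr => j _ do
      rewrite !big_split /= sum_nat_const card_ord !E.
    under eq_bigr => i _ do rewrite !big_split /= -big_distrr /= E !sum_nat_const card_ord.
    by rewrite sum_nat_const card_ord; lia.
  rewrite big_distrr /= /NP -big_split /=; apply: leq_sum => i _.
  rewrite big_distrr /= -big_split /=; apply: leq_sum => j _.
  rewrite big_distrr /= -big_split /=; apply: leq_sum => k _; rewrite /P.
  have := NS (i %% q) (j %% q) (k %% q).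
  by case: (i == j); case: (i == k); case: (j == k) => /=; lia.
suff : NP * 2 ^ n <= size cs * (48 * LambdaHn n H) by move: diag; nia.
have -> : size cs * (48 * LambdaHn n H) = \sum_(c <- cs) 48 * LambdaHn n H.
  by rewrite big_const_seq count_predT iter_addn_0 mulnC.
apply: (@leq_trans (\sum_(c <- cs) 48 * LambdaHS H (weight_set q d T n c))).
  under eq_bigr do rewrite LambdaHS_frames.
  rewrite exchange_big /=.
  under eq_bigr => u Pu do rewrite count_weight_set //.
  rewrite -/N /NP.
  have -> : \sum_(u : frame n | proper_frame u) N (u.2.1.1 %% q) (u.2.1.2 %% q) (u.2.2 %% q)
    = \sum_(x : cube n) \sum_(t : 'I_n * 'I_n * 'I_n)
       (if P t.1.1 t.1.2 t.2 then N (t.1.1 %% q) (t.1.2 %% q) (t.2 %% q) else 0).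
    by rewrite pair_big /= big_mkcond /=; apply: eq_bigr => -[x [[i j] k]].
  rewrite sum_nat_const card_ffun card_bool card_ord mulnC leq_mul2l.
  apply/orP; right; rewrite pair_big pair_big /=; apply: eq_leq.
  by apply: eq_bigr => -[[i j] k].
apply: leq_sum => c _; rewrite leq_mul2l /=.
exact: (leq_bigmax (weight_set q d T n c)).
Qed.

(** * The limits *)

(** 48 times the number of 3-subcubes is [n (n - 1) (n - 2) 2 ^ n], so both bounds have leading term
    [a / b] and the error is O(1/n). *)
Lemma induc_ratio_cvg (R : realType) (H : {set cube 3}) (a b q : nat) :
  0 < b ->
  (forall n (S : {set cube n}), b * (48 * LambdaHS H S) <= a * (2 ^ n * n ^ 3)) ->
  (forall n, a * (n - q) ^ 3 * 2 ^ n <= b * (48 * LambdaHn n H + 3 * n ^ 2 * 2 ^ n)) ->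
  (induc_ratio R H @ \oo --> (a%:R / b%:R : R))%classic%R.
Proof.
move=> b0 Hup Hlo; pose l : R := (a%:R / b%:R)%R.
have b0R : (0 < b%:R :> R)%R by rewrite ltr0n.
have l0 : (0 <= l)%R by rewrite divr_ge0.
have up n : b * (48 * LambdaHn n H) <= a * (2 ^ n * n ^ 3).
  have S0 : 0 < #|{: {set cube n}}| by apply/card_gt0P; exists finset.set0.
  by rewrite /LambdaHn; have [S ->] := bigop.eq_bigmax (@LambdaHS 3 n H) S0.
(* The part [3 l q] pays for rounding [n] to a multiple of [q], the 3 for degenerate triples, and
   [6 l] for replacing [n ^ 3] by the falling factorial. *)
pose M : R := (l * (6 + 3 * q%:R) + 3)%R.
have bound n : (6 <= n)%N -> (q <= n)%N ->
    (`|induc_ratio R H n - l| <= M * n%:R^-1)%R.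
  move=> n6 qn; have n0 : (0 < n%:R :> R)%R by rewrite ltr0n; lia.
  have n6R : (6 <= n%:R :> R)%R by rewrite ler_nat.
  have p0 : (0 < 2 ^+ n :> R)%R by rewrite exprn_gt0.
  pose D : R := (n%:R * (n%:R - 1) * (n%:R - 2))%R.
  have D0 : (0 < D)%R by rewrite !mulr_gt0 //; lra.
  have den : (48 * ('C(n, 3) * 2 ^ (n - 3))%:R = D * 2 ^+ n :> R)%R.
    have E1 : 'C(n, 3) * 6 = n * (n - 1) * (n - 2).
      rewrite -[6]/(3`!) bin_ffact; case: n n6 {qn n0 n6R p0 D D0} => [|[|n]] // _.
      by rewrite !ffactnS ffactn0; lia.
    have E2 : 2 ^ n = 8 * 2 ^ (n - 3) by rewrite -[8]/(2 ^ 3) -expnD subnKC //; lia.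
    have N1 : (n%:R - 1 = (n - 1)%:R :> R)%R by rewrite natrB //; lia.
    have N2 : (n%:R - 2 = (n - 2)%:R :> R)%R by rewrite natrB //; lia.
    rewrite /D N1 N2 -natrX E2 -!natrM -E1; congr (_%:R)%R; lia.
  have E : induc_ratio R H n = (48 * (LambdaHn n H)%:R / (D * 2 ^+ n))%R.
    have D2 : (D * 2 ^+ n != 0)%R by rewrite mulf_neq0 ?gt_eqF.
    rewrite /induc_ratio -den; rewrite -den in D2.
    move: ((_ * _)%:R)%R D2 => d; rewrite mulf_eq0 negb_or => /andP[_ d0].
    by field.
  have U : (b%:R * (48 * (LambdaHn n H)%:R) <= a%:R * (2 ^+ n * n%:R ^+ 3) :> R)%R.
    by have := up n; rewrite -(ler_nat R) !natrM !natrX.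
  have L : (a%:R * (n%:R - q%:R) ^+ 3 * 2 ^+ n <=
      b%:R * (48 * (LambdaHn n H)%:R + 3 * n%:R ^+ 2 * 2 ^+ n) :> R)%R.
    by have := Hlo n; rewrite -(ler_nat R) !(natrM, natrX, natrD) natrB.
  pose y : R := (48 * (LambdaHn n H)%:R / 2 ^+ n)%R.
  have Ey : (48 * (LambdaHn n H)%:R = y * 2 ^+ n :> R)%R.
    by rewrite /y divfK // gt_eqF.
  have al : (a%:R = l * b%:R :> R)%R by rewrite /l divfK // gt_eqF.
  have {}U : (y <= l * n%:R ^+ 3)%R.
    rewrite -(ler_pM2r p0) -(ler_pM2l b0R); rewrite Ey al in U.
    by apply: le_trans U _; rewrite le_eqVlt; apply/orP; left; apply/eqP; ring.
  have {}L : (l * (n%:R - q%:R) ^+ 3 - 3 * n%:R ^+ 2 <= y)%R.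
    rewrite -(ler_pM2r p0) -(ler_pM2l b0R) -subr_ge0.
    move: L; rewrite Ey al -subr_ge0 => L; apply: le_trans L _.
    by rewrite le_eqVlt; apply/orP; left; apply/eqP; ring.
  have -> : induc_ratio R H n = (y / D)%R.
    by rewrite E Ey; field; rewrite !gt_eqF.
  have y0 : (0 <= y)%R by rewrite divr_ge0 // ltW.
  have qR : (q%:R <= n%:R :> R)%R by rewrite ler_nat.
  have q0 : (0 <= q%:R :> R)%R by [].
  move: (n%:R)%R (q%:R)%R n0 n6R @D D0 den E U L qR q0 @M => N Q n0 n6R D D0 _ _ U L qR q0 M.
  rewrite ler_distl; apply/andP; split.
    (* A nonpositive lower bound is trivial; otherwise [D] may be replaced by the larger [N ^ 3]. *)
    rewrite ler_pdivlMr //; have [le0|/ltW ge0] := leP (l - M / N)%R 0%R.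
      by apply: le_trans y0; rewrite mulr_le0_ge0 // ltW.
    apply: (@le_trans _ _ ((l - M / N) * N ^+ 3)%R).
      by rewrite ler_wpM2l // /D; nra.
    apply: le_trans L.
    have -> : ((l - M / N) * N ^+ 3 = l * N ^+ 3 - M * N ^+ 2)%R.
      by field; rewrite gt_eqF.
    suff : (0 <= l * (3 * N ^+ 2 * Q + (N - Q) ^+ 3 - N ^+ 3) + 6 * l * N ^+ 2)%R.
      by rewrite /M; lra.
    by rewrite addr_ge0 // mulr_ge0 //; nra.
  rewrite ler_pdivrMr //; apply: (le_trans U).
  have -> : ((l + M / N) * D = l * ((1 + 6 / N) * D) + (M - 6 * l) / N * D)%R.
    by field; rewrite gt_eqF.
  (* For [N] at least 6 this product is at least [N ^ 3]. *)
  have -> : ((1 + 6 / N) * D = (N + 6) * (N - 1) * (N - 2))%R.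
    by rewrite /D; field; rewrite gt_eqF.
  apply: ler_wpDr.
    by rewrite mulr_ge0 ?(ltW D0) // divr_ge0 ?(ltW n0) // /M; nra.
  by rewrite ler_wpM2l //; nra.
apply/cvgrPdist_le => e e0; near=> n.
rewrite distrC; apply: le_trans (bound n _ _) _.
- by near: n; apply: nbhs_infty_ge.
- by near: n; apply: nbhs_infty_ge.
- rewrite ler_pdivrMr; last first.
    by rewrite ltr0n; near: n; apply: nbhs_infty_gt.
  rewrite -ler_pdivrMl // mulrC; near: n; exact: nbhs_infty_ger.
Unshelve. all: by end_near.
Qed.

Definition good_total (K : zmodType) (cs : seq K) (q : nat) (d : nat -> K)
    (T : K -> bool) (h : cell -> bool) : nat :=
  sumn [seq sumn [seq sumn [seq good_shifts cs d T h a b e | e <- iota 0 q]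
    | b <- iota 0 q] | a <- iota 0 q].

(** The equation on [good_total] says that the proportion of good choices of a shift and three
    classes is exactly [a / b]. *)
Lemma induc_ratio_cvg_construction (R : realType) (K : zmodType) (cs : seq K)
    (q : nat) (d : nat -> K) (T : K -> bool) (H : {set cube 3}) (a b : nat) :
  0 < b -> 0 < q -> uniq cs -> (forall c, c \in cs) ->
  b * good_total cs q d T (set_cells H) = a * (size cs * q ^ 3) ->
  (forall n (S : {set cube n}), b * (48 * LambdaHS H S) <= a * (2 ^ n * n ^ 3)) ->
  (induc_ratio R H @ \oo --> (a%:R / b%:R : R))%classic%R.
Proof.
move=> b0 q0 csU csF E up; apply: (@induc_ratio_cvg _ _ a b q) => // n.
have cs0 : 0 < size cs by case: cs csF {csU E} => // /(_ 0%R).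
rewrite -(leq_pmul2l cs0); apply: (@leq_trans (b * ((n %/ q) ^ 3 *
    good_total cs q d T (set_cells H) * 2 ^ n))); last first.
  rewrite [leqRHS]mulnCA leq_mul2l; apply/orP; right.
  exact: weight_set_bound.
have nq : n - q <= q * (n %/ q).
  by rewrite {1}(divn_eq n q) mulnC leq_subLR addnC leq_add2r ltnW ?ltn_pmod.
move: E (n %/ q) nq => E m nq; set G := good_total _ _ _ _ _ in E *.
have -> : b * (m ^ 3 * G * 2 ^ n) = b * G * (m ^ 3 * 2 ^ n) by ring.
have -> : b * G * (m ^ 3 * 2 ^ n) = size cs * (a * (q * m) ^ 3 * 2 ^ n).
  by rewrite E expnMn; ring.
by rewrite !leq_mul // leq_exp2r.
Qed.

(** * The extremal sets and their counts *)

Definition elems3 : seq 'I_3 := [:: @Ordinal 3 0 isT; @Ordinal 3 1 isT; @Ordinal 3 2 isT].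
Definition elems4 : seq 'I_4 :=
  [:: @Ordinal 4 0 isT; @Ordinal 4 1 isT; @Ordinal 4 2 isT; @Ordinal 4 3 isT].

Lemma mem_elems3 (c : 'I_3) : c \in elems3.
Proof. by case: c => [[|[|[|]]]]. Qed.

Lemma mem_elems4 (c : 'I_4) : c \in elems4.
Proof. by case: c => [[|[|[|[|]]]]]. Qed.

Definition bools : seq bool := [:: false; true].

Definition elems9 : seq ('I_4 * bool) := [seq (c, e) | c <- elems4, e <- bools].

Definition step9 (a : nat) : 'I_4 * bool :=
  if a is 0 then (@Ordinal 4 0 isT, true) else (@Ordinal 4 1 isT, false).

(** A step in the parity component complements membership. *)
Definition target9 (c : 'I_4 * bool) : bool := (c.1 < 2) (+) c.2.

Notation bool6 := (bool * bool * bool * bool * bool * bool)%type.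

Definition elems10 : seq bool6 :=
  [seq (c, e) | c <- [seq (c, e) | c <- [seq (c, e) | c <- cells, e <- bools],
     e <- bools], e <- bools].

Definition step10 (a : nat) : bool6 :=
  (a == 0, a == 1, a == 2, a == 3, a == 4, a == 5).

(* Up to a global sign, [x] agrees with a row of the symmetric conference
   matrix of order 6 off the diagonal: the 24 elements are the rows of a
   Hadamard matrix of order 12 and their opposites, cut to six columns. *)
Definition target10 (x : bool6) : bool :=
  let: (x0, x1, x2, x3, x4, y) := x in
  let row a b c d := [&& a == y, b == y, c != y & d != y] in
  [|| [&& x0 == x1, x1 == x2, x2 == x3 & x3 == x4],
      row x1 x4 x2 x3, row x2 x0 x3 x4, row x3 x1 x4 x0,
      row x4 x2 x0 x1 | row x0 x3 x1 x2].

(** With a single class the total is the number of good shifts: 1 of 3 here, then 2 of 3 for [W8]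
    and 2 of 4 for [W12]. *)
Lemma good_total7 : good_total elems3 1 (fun=> @Ordinal 3 1 isT)
  (fun c : 'I_3 => val c == 0) (seq_cells cells7) = 1.
Proof. by vm_compute. Qed.

Lemma good_total8 : good_total elems3 1 (fun=> @Ordinal 3 1 isT)
  (fun c : 'I_3 => val c == 0) (seq_cells cells8) = 2.
Proof. by vm_compute. Qed.

Lemma good_total12 : good_total elems4 1 (fun=> @Ordinal 4 1 isT)
  (fun c : 'I_4 => c < 2) (seq_cells cells12) = 2.
Proof. by vm_compute. Qed.

(** 96 is 4/9 of the 8 * 27 choices of a shift and three classes. *)
Lemma good_total9 : good_total elems9 3 step9 target9 (seq_cells cells9) = 96.
Proof. by vm_compute. Qed.

(** 5760 is 5/12 of 64 * 216; binary numbers avoid a large unary numeral. *)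
Lemma good_total10 :
  N.of_nat (good_total elems10 6 step10 target10 (seq_cells cells10)) = 5760%num.
Proof. by rewrite -(tabulateE (seq_cells cells10)); vm_compute. Qed.

Local Open Scope classical_set_scope.
Local Open Scope ring_scope.

(* lambda(H) = lim_{n->oo} Lambda(H,n) / (binom(n,3) 2^(n-3)) *)
Theorem theorem1p1 (R : realType) :
  [/\ induc_ratio R W7 @ \oo --> (1 / 3 : R),
      induc_ratio R W8 @ \oo --> (2 / 3 : R),
      induc_ratio R W9 @ \oo --> (4 / 9 : R),
      induc_ratio R W10 @ \oo --> (5 / 12 : R)
    & induc_ratio R W12 @ \oo --> (1 / 2 : R)].
Proof.
have [E7 E8 E9 E10 E12] := set_cells_W.
split.
- apply: (@induc_ratio_cvg_construction R _ elems3 1 (fun=> @Ordinal 3 1 isT)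
    (fun c : 'I_3 => val c == 0)%N W7 1 3) => //; first exact: mem_elems3.
    by rewrite E7 good_total7.
  by move=> n S; apply: (@certified_bound _ _ _ _ _ squares7); rewrite // E7; exact: certified7.
- apply: (@induc_ratio_cvg_construction R _ elems3 1 (fun=> @Ordinal 3 1 isT)
    (fun c : 'I_3 => val c == 0)%N W8 2 3) => //; first exact: mem_elems3.
    by rewrite E8 good_total8.
  exact: W8_bound.
- apply: (@induc_ratio_cvg_construction R _ elems9 3 step9 target9 W9 4 9) => //.
  + by case=> c e; apply: allpairs_f; [exact: mem_elems4|case: e].
  + by rewrite E9 good_total9.
  + move=> n S; have : (36 * (48 * LambdaHS W9 S) <= 16 * (2 ^ n * n ^ 3))%N.
      by apply: (@certified_bound _ _ _ _ _ squares9); rewrite // E9; exact: certified9.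
    by move: (2 ^ n * n ^ 3)%N (48 * LambdaHS W9 S)%N => X Y; lia.
- apply: (@induc_ratio_cvg_construction R _ elems10 6 step10 target10 W10 5 12) => //.
  + have mem_bools e : e \in bools by case: e.
    by move=> [[[c e] e'] e'']; rewrite !allpairs_f ?mem_cells.
  + have := good_total10; rewrite E10; have -> : size elems10 = 64%N by [].
    by move: (good_total _ _ _ _ _) => g; rewrite !expnS expn0; lia.
  + move=> n S; have : (60 * (48 * LambdaHS W10 S) <= 25 * (2 ^ n * n ^ 3))%N.
      by apply: (@certified_bound _ _ _ _ _ squares10); rewrite // E10; exact: certified10.
    by move: (2 ^ n * n ^ 3)%N (48 * LambdaHS W10 S)%N => X Y; lia.
- apply: (@induc_ratio_cvg_construction R _ elems4 1 (fun=> @Ordinal 4 1 isT)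
    (fun c : 'I_4 => c < 2)%N W12 1 2) => //; first exact: mem_elems4.
    by rewrite E12 good_total12.
  by move=> n S; apply: (@certified_bound _ _ _ _ _ squares12); rewrite // E12; exact: certified12.
Qed.
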